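(* $$\sum_{k=1}^\infty\frac{3^k}{k^2\binom{2k}{k}}\left(6S_1(2k)-8S_1(k)+\frac5k\right)=\frac{26}{3}\zeta_3.$$
   Context: $S_1(n):=\sum_{i=1}^n \frac1i$ is the $n$-th harmonic number, and $\zeta_3:=\sum_{i=1}^\infty \frac{1}{i^3}$. *)

(* Defs.v *)
From Stdlib Require Import Reals.
From Coquelicot Require Import Coquelicot.
Open Scope R_scope.

(* [sum_n_m a 1 0] is the empty sum, so [S1 0 = 0]. *)
Definition S1 (n : nat) : R := sum_n_m (fun i : nat => / INR i) 1 n.

(* [Series] starts at index 0; the shift [S i] starts the sum at 1. *)
Definition zeta3 : R := Series (fun i : nat => / (INR (S i)) ^ 3).

(* Main.v *)
Require Import Defs.
From Stdlib Require Import Reals Lra Lia.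
From Coquelicot Require Import Coquelicot.
Open Scope R_scope.

(** The series is the second-order Taylor coefficient at [A = 0] of a
one-parameter family of hypergeometric series that satisfies a first-order
recurrence.  With rising factorials [(a)_k], put
[[
  L(A) = sum_{k>=1} 3^k (A)_k (A/3)_k / (k (A)_{2k}).
]]
Its term is [A/k] times [weight (k-1) A].  Since [weight (k-1) 0] equals
[(2/3) 3^k / (k C(2k,k))], and since its logarithmic derivative in [A] at [0]
is [4/3 H_{k-1} - H_{2k-1}], which is [-1/6] of the harmonic factor of the theorem,
the coefficient of [A^2] in [L] is [-1/9] of the required sum.

On the other hand, a Wilf-Zeilberger certificate gives
[L(A+3) - L(A) = 1/(A+1) + 1/(A+2)] (lemma [L_shift]).  This determines [L] once
its growth at infinity is controlled: each factor of the product [A * weight j A]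
is nondecreasing in [A], hence so is [L], and for [0 <= A <= 1] the difference
[L(A+3M) - L(3M)] lies between [0] and [L(3M+3) - L(3M)], which tends to [0].
As [L(0) = 0], summing the recurrence yields (lemma [L_expansion])
[[
  L(A) = A sum_{m>=0} (1/((3m+1)(3m+1+A)) + 1/((3m+2)(3m+2+A))).
]]
Here the coefficient of [A^2] is minus the sum of [1/n^3] over the [n] prime
to [3], that is [-(1 - 1/27) zeta(3)]; multiplication by [-9] gives
[26/3 zeta(3)].

The comparison of coefficients needs no differentiation of series: both
expansions of [L(A)/A] are approximated termwise to first order with an error
at most [A^2] times a summable sequence, and [Series_first_order_coeff]
concludes.  For the hypergeometric side, the error bound is
[growth_first_order], proved by induction along the product. *)

(** * Series of real numbers *)

Lemma ex_series_dominated (a b : nat -> R) :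
  (forall n, Rabs (a n) <= b n) -> ex_series b -> ex_series a.
Proof. exact (@ex_series_le R_AbsRing R_CompleteNormedModule a b). Qed.

Lemma INR_S_ge1 j : 1 <= INR (S j).
Proof. rewrite S_INR. pose proof (pos_INR j). lra. Qed.

Lemma exists_INR_ge A : exists n, A <= INR n.
Proof.
destruct (nfloor_ex (Rmax 0 A) (Rmax_l 0 A)) as [n [_ Hn]].
exists (S n). rewrite S_INR. pose proof (Rmax_r 0 A). lra.
Qed.

Lemma is_lim_seq_inv_INR_S : is_lim_seq (fun m => / INR (S m)) 0.
Proof.
apply -> (is_lim_seq_incr_1 (fun m => / INR m)).
change (Finite 0) with (Rbar_inv p_infty).
apply is_lim_seq_inv; [apply is_lim_seq_INR|discriminate].
Qed.

Lemma is_series_telescope (b : nat -> R) :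
  is_lim_seq b 0 -> is_series (fun n => b n - b (S n)) (b 0%nat).
Proof.
intros Hb.
assert (H : is_lim_seq (sum_n (fun n => b n - b (S n))) (b 0%nat)); [|exact H].
apply is_lim_seq_ext with (fun n => b 0%nat - b (S n)).
- intros n. induction n as [|n IH].
  + now rewrite sum_O.
  + rewrite sum_Sn, <- IH. change plus with Rplus. cbn beta. ring.
- replace (Finite (b 0%nat)) with (Finite (b 0%nat - 0)) by (f_equal; ring).
  apply is_lim_seq_minus'; [apply is_lim_seq_const|].
  now apply (is_lim_seq_incr_1 b).
Qed.

Lemma small_of_linear_bound s K :
  (forall x, 0 < x <= 1 -> Rabs s <= x * K) -> s = 0.
Proof.
intros H. destruct (Req_dec s 0) as [|Hs]; [trivial|exfalso].
apply Rabs_pos_lt in Hs. assert (H1 := H 1).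
assert (Hx : 0 < Rabs s / (2 * K) <= 1).
{ split; [apply Rdiv_lt_0_compat; lra|apply Rle_div_l; lra]. }
assert (H2 := H _ Hx).
replace (Rabs s / (2 * K) * K) with (Rabs s / 2) in H2 by (field; lra). lra.
Qed.

(** Equality of first-order coefficients under an identity between series,
stated for the difference of both sides: [a n + x * b n] approximates
the term [e x n] with a summable second-order error, so
[Series a + x * Series b] is [O(x^2)] and both sums vanish. *)
Lemma Series_first_order_coeff (e : R -> nat -> R) (a b B : nat -> R) :
  ex_series a -> ex_series b -> ex_series B ->
  (forall x n, 0 < x <= 1 -> Rabs (e x n - a n - x * b n) <= x ^ 2 * B n) ->
  (forall x, 0 < x <= 1 -> is_series (e x) 0) ->
  Series b = 0.
Proof.
intros Ha Hb HB Hbound Hzero.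
assert (H : forall x, 0 < x <= 1 ->
  Rabs (Series a + x * Series b) <= x ^ 2 * Series B).
{ intros x Hx. assert (He := Hzero x Hx).
  assert (Hex : ex_series (e x)) by (now exists 0).
  assert (Hxb : ex_series (fun n => x * b n)) by now apply (ex_series_scal x b).
  rewrite <- Series_scal_l.
  replace (Series a + _)
    with (- Series (fun n => e x n - a n - x * b n)).
  2:{ rewrite (Series_minus (fun n => e x n - a n)); trivial.
      - rewrite Series_minus by trivial. rewrite (is_series_unique _ _ He), Series_scal_l. ring.
      - now apply (ex_series_minus (e x) a). }
  rewrite Rabs_Ropp, <- Series_scal_l.
  assert (HxB : ex_series (fun n => x ^ 2 * B n))
    by now apply (ex_series_scal (x ^ 2) B).
  eapply Rle_trans; [apply Series_Rabs|].
  - apply ex_series_dominated with (fun n => x ^ 2 * B n); trivial.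
    intros n. rewrite Rabs_Rabsolu. now apply Hbound.
  - apply Series_le; trivial. intros n. split; [apply Rabs_pos|now apply Hbound]. }
set (s := Series a) in *. set (t := Series b) in *. set (K := Series B) in *.
assert (HK : 0 <= K).
{ assert (H1 := H 1). pose proof (Rabs_pos (s + 1 * t)). lra. }
assert (Hs : s = 0).
{ apply small_of_linear_bound with (Rabs t + K). intros x Hx.
  assert (Hx' := H x Hx).
  assert (Htri : Rabs s <= Rabs (s + x * t) + Rabs (x * t)).
  { replace s with ((s + x * t) + - (x * t)) at 1 by ring.
    rewrite <- (Rabs_Ropp (x * t)). apply Rabs_triang. }
  rewrite (Rabs_mult x t), (Rabs_pos_eq x) in Htri by lra.
  assert (x ^ 2 * K <= x * K) by (apply Rmult_le_compat_r; nra).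
  lra. }
apply small_of_linear_bound with K. intros x Hx.
assert (Hx' := H x Hx). rewrite Hs, Rplus_0_l, Rabs_mult, Rabs_pos_eq in Hx' by lra.
apply Rmult_le_reg_l with x; [lra|]. lra.
Qed.

Lemma ex_series_inv_squares : ex_series (fun m => / INR (S m) ^ 2).
Proof.
apply ex_series_dominated with (fun m => 2 * (/ INR (S m) - / INR (S (S m)))).
- intros m. pose proof (INR_S_ge1 m) as Hi. rewrite (S_INR (S m)).
  set (i := INR (S m)) in *. assert (0 < i ^ 2) by nra.
  rewrite Rabs_pos_eq by (left; now apply Rinv_0_lt_compat).
  replace (2 * _) with (/ (i * (i + 1) / 2)) by (field; lra).
  apply Rinv_le_contravar; nra.
- apply (ex_series_scal 2 (fun m => / INR (S m) - / INR (S (S m)))).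
  exists (/ INR 1). apply (is_series_telescope (fun m => / INR (S m))).
  apply is_lim_seq_inv_INR_S.
Qed.

Lemma ex_series_inv_cubes : ex_series (fun m => / INR (S m) ^ 3).
Proof.
apply ex_series_dominated with (fun m => / INR (S m) ^ 2).
- intros m. pose proof (INR_S_ge1 m) as Hi. set (i := INR (S m)) in *.
  assert (0 < i ^ 2) by nra. assert (i ^ 2 <= i ^ 3) by nra.
  rewrite Rabs_pos_eq by (left; apply Rinv_0_lt_compat; lra).
  apply Rinv_le_contravar; lra.
- exact ex_series_inv_squares.
Qed.

(** * The hypergeometric family and its monotonicity *)

(** With [T k A = 3^k (A)_k (A/3)_k / (A)_{2k}], this is [T (i+1) A / T i A]. *)
Definition step (i : nat) (A : R) : R :=
  (A + INR i) * (A + 3 * INR i)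
  / ((A + 2 * INR i) * (A + 2 * INR i + 1)).

(** [A * weight j A] is the product of [step i A] over [0 <= i <= j]: the factor
[step 0 A], which is [A / (A + 1)] for positive [A], is replaced by
[/ (A + 1)] so that the case [A = 0] is not degenerate. *)
Fixpoint weight (j : nat) (A : R) : R :=
  match j with
  | O => / (A + 1)
  | S j' => weight j' A * step j A
  end.

Lemma step_pos j A : 0 <= A -> 0 < step (S j) A.
Proof.
intros HA. pose proof (INR_S_ge1 j). unfold step.
apply Rdiv_lt_0_compat; apply Rmult_lt_0_compat; lra.
Qed.

Lemma step_incr j A A' : 0 <= A -> A <= A' -> step (S j) A <= step (S j) A'.
Proof.
intros HA HAA'. pose proof (INR_S_ge1 j) as Hi. unfold step.
set (i := INR (S j)) in *.
assert (0 < (A + 2 * i) * (A + 2 * i + 1)) by (apply Rmult_lt_0_compat; lra).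
assert (0 < (A' + 2 * i) * (A' + 2 * i + 1)) by (apply Rmult_lt_0_compat; lra).
apply Rminus_le_0.
replace (_ - _) with
  ((A' - A) * (A * A' + (i * i + 2 * i) * (A + A') + i * i * (4 * i + 5))
   / (((A + 2 * i) * (A + 2 * i + 1)) * ((A' + 2 * i) * (A' + 2 * i + 1))))
  by (field; repeat split; lra).
apply Rdiv_le_0_compat; [ | now apply Rmult_lt_0_compat].
apply Rmult_le_pos; [lra|].
assert (0 <= A * A') by (apply Rmult_le_pos; lra).
assert (0 <= (i * i + 2 * i) * (A + A')) by (apply Rmult_le_pos; nra).
assert (0 <= i * i * (4 * i + 5)) by (apply Rmult_le_pos; nra).
lra.
Qed.

Lemma step_le j A c :
  0 <= A -> (A + INR (S j)) * (A + 3 * INR (S j))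
     <= c * ((A + 2 * INR (S j)) * (A + 2 * INR (S j) + 1)) ->
  step (S j) A <= c.
Proof.
intros HA H. pose proof (INR_S_ge1 j). unfold step.
apply Rle_div_l; [|exact H]. apply Rmult_lt_0_compat; lra.
Qed.

Lemma step_le1 j A : 0 <= A -> step (S j) A <= 1.
Proof.
intros HA. pose proof (INR_S_ge1 j). apply step_le; [exact HA|]. nra.
Qed.

(** The limit of [step i A] in [i] is [3 / 4], but the convergence is not uniform
in [A]; the threshold [A <= i] suffices for the ratio [9 / 10]. *)
Lemma step_le_geom j A : 0 <= A <= INR (S j) -> step (S j) A <= 9 / 10.
Proof.
intros HA. pose proof (INR_S_ge1 j). apply step_le; [lra|]. nra.
Qed.

Lemma weight_pos j A : 0 <= A -> 0 < weight j A.
Proof.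
intros HA. induction j as [|j IH]; cbn [weight].
- apply Rinv_0_lt_compat; lra.
- now apply Rmult_lt_0_compat, step_pos.
Qed.

Lemma weight_le1 j A : 0 <= A -> weight j A <= 1.
Proof.
intros HA. induction j as [|j IH]; cbn [weight].
- rewrite <- Rinv_1. apply Rinv_le_contravar; lra.
- rewrite <- (Rmult_1_r 1). apply Rmult_le_compat; trivial.
  + left; now apply weight_pos.
  + left; now apply step_pos.
  + now apply step_le1.
Qed.

Lemma weight_geom n d A :
  0 <= A <= INR n -> weight (n + d) A <= (9 / 10) ^ d.
Proof.
intros HA. induction d as [|d IH].
- rewrite Nat.add_0_r. now apply weight_le1.
- rewrite Nat.add_succ_r. cbn [weight pow]. rewrite (Rmult_comm (9 / 10)).
  apply Rmult_le_compat; trivial.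
  + left; apply weight_pos; lra.
  + left; apply step_pos; lra.
  + apply step_le_geom. split; [lra|]. apply Rle_trans with (INR n); [lra|].
    apply le_INR; lia.
Qed.

Lemma is_lim_seq_weight A : 0 <= A -> is_lim_seq (fun j => weight j A) 0.
Proof.
intros HA. destruct (exists_INR_ge A) as [n Hn].
apply (is_lim_seq_incr_n _ n).
apply is_lim_seq_le_le with (fun _ => 0) (fun d => (9 / 10) ^ d).
- intros d. rewrite Nat.add_comm. split.
  + left; now apply weight_pos.
  + now apply weight_geom.
- apply is_lim_seq_const.
- apply is_lim_seq_geom. rewrite Rabs_pos_eq; lra.
Qed.

Lemma ex_series_weight A : 0 <= A -> ex_series (fun j => weight j A).
Proof.
intros HA. destruct (exists_INR_ge A) as [n Hn].
apply (ex_series_incr_n _ n).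
apply ex_series_dominated with (fun d => (9 / 10) ^ d).
- intros d. rewrite Rabs_pos_eq.
  + now apply weight_geom.
  + left; now apply weight_pos.
- apply ex_series_geom. rewrite Rabs_pos_eq; lra.
Qed.

Definition summand (A : R) (j : nat) : R := A * weight j A / INR (S j).

(** The factor [A] is essential: [weight j A] itself need not increase, since
its initial factor [/ (A + 1)] decreases. *)
Lemma A_weight_incr j A A' :
  0 <= A -> A <= A' -> A * weight j A <= A' * weight j A'.
Proof.
intros HA HAA'. induction j as [|j IH].
- cbn [weight]. apply Rle_div_l; [lra|].
  replace (A' * / (A' + 1) * (A + 1)) with (A' * (A + 1) / (A' + 1)) by (field; lra).
  apply Rle_div_r; [lra|]. nra.
- cbn [weight]. rewrite <- !Rmult_assoc.
  apply Rmult_le_compat; [|left; now apply step_pos|trivial|now apply step_incr].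
  apply Rmult_le_pos; [trivial|left; now apply weight_pos].
Qed.

Lemma summand_pos A j : 0 <= A -> 0 <= summand A j.
Proof.
intros HA. pose proof (INR_S_ge1 j). apply Rdiv_le_0_compat; [|lra].
apply Rmult_le_pos; [trivial|left; now apply weight_pos].
Qed.

Lemma ex_series_summand A : 0 <= A -> ex_series (summand A).
Proof.
intros HA. apply ex_series_dominated with (fun j => A * weight j A).
- intros j. rewrite Rabs_pos_eq by now apply summand_pos.
  pose proof (INR_S_ge1 j). apply Rle_div_l; [lra|].
  assert (0 <= A * weight j A)
    by (apply Rmult_le_pos; [trivial|left; now apply weight_pos]).
  nra.
- apply (ex_series_scal A (fun j => weight j A)). now apply ex_series_weight.
Qed.

(** In closed form, for [0 <= A], [L A = psi(1 + A) - psi(1) - (psi(1 + A/3) - psi(1)) / 3],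
where [psi] is the digamma function. *)
Definition L (A : R) : R := Series (summand A).

(** Monotonicity replaces an asymptotic analysis of [L] at infinity. *)
Lemma L_incr A A' : 0 <= A -> A <= A' -> L A <= L A'.
Proof.
intros HA HAA'. apply Series_le; [|apply ex_series_summand; lra].
intros j. split; [now apply summand_pos|].
apply Rmult_le_compat_r; [|now apply A_weight_incr].
left; apply Rinv_0_lt_compat. pose proof (INR_S_ge1 j). lra.
Qed.

(** * The recurrence in the parameter *)

(** The shift [A + 3] moves [(A)_k] by three factors, [(A/3)_k] by one and
[(A)_{2k}] by three, so the quotient is a rational function of [A] and [k].
The factor [A] of the unshifted side is cancelled, which keeps the identity
meaningful at [A = 0]. *)
Lemma weight_shift j A : 0 <= A ->
  let k := INR (S j) in
  (A + 3) * weight j (A + 3) =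
  weight j A * ((A + k) * (A + k + 1) * (A + k + 2) * (A + 3 * k)
    / ((A + 2 * k) * (A + 2 * k + 1) * (A + 2 * k + 2))).
Proof.
intros HA. induction j as [|j IH]; cbn zeta in *.
- cbn [weight INR]. field. lra.
- cbn [weight]. rewrite <- Rmult_assoc, IH. unfold step.
  rewrite (S_INR (S j)).
  pose proof (INR_S_ge1 j) as Hi. set (i := INR (S j)) in *.
  field. repeat split; lra.
Qed.

(** The Wilf-Zeilberger companion, up to sign, of the term of index
[k = j + 1]: the rational multiple [(2 A + 3 k) / (A + 2 k)] of
[weight j A] whose difference in [j] is the difference of summands in [A]. *)
Definition certificate (A : R) (j : nat) : R :=
  weight j A * ((2 * A + 3 * INR (S j)) / (A + 2 * INR (S j))).

Lemma summand_telescope A j : 0 <= A ->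
  summand (A + 3) j - summand A j = certificate A j - certificate A (S j).
Proof.
intros HA. unfold summand, certificate. rewrite (weight_shift j A HA).
cbn [weight]. unfold step. rewrite (S_INR (S j)).
pose proof (INR_S_ge1 j) as Hi. set (i := INR (S j)) in *.
field. repeat split; lra.
Qed.

Lemma is_lim_seq_certificate A : 0 <= A -> is_lim_seq (certificate A) 0.
Proof.
intros HA.
apply is_lim_seq_le_le with (fun _ => 0) (fun j => 2 * weight j A).
- intros j. pose proof (INR_S_ge1 j) as Hi. pose proof (weight_pos j A HA).
  unfold certificate. set (i := INR (S j)) in *.
  assert (0 <= (2 * A + 3 * i) / (A + 2 * i) <= 2).
  { split; [apply Rdiv_le_0_compat; lra|apply Rle_div_l; lra]. }
  split; nra.
- apply is_lim_seq_const.
- replace (Finite 0) with (Rbar_mult 2 0) by (cbn; now rewrite Rmult_0_r).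
  apply is_lim_seq_scal_l. now apply is_lim_seq_weight.
Qed.

(** Only the boundary value [certificate A 0] survives the telescoping. *)
Lemma L_shift A : 0 <= A -> L (A + 3) - L A = / (A + 1) + / (A + 2).
Proof.
intros HA. unfold L. rewrite <- Series_minus; try (apply ex_series_summand; lra).
apply is_series_unique.
replace (/ (A + 1) + / (A + 2)) with (certificate A 0)
  by (unfold certificate; cbn [weight INR]; field; lra).
apply is_series_ext with (fun j => certificate A j - certificate A (S j)).
- intros j. symmetry. now apply summand_telescope.
- now apply is_series_telescope, is_lim_seq_certificate.
Qed.

Lemma L_0 : L 0 = 0.
Proof.
unfold L.
rewrite (Series_ext _ (fun j => 0 * summand 0 j)), Series_scal_l; [ring|].
intros j. unfold summand, Rdiv. ring.
Qed.

(** [A * kernel A m] is the increment [1/(3m+1) + 1/(3m+2)] of [L] from [3m] to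
[3m+3] minus its increment from [A+3m] to [A+3m+3], written as a multiple
of [A]. *)
Definition kernel (A : R) (m : nat) : R :=
  / ((3 * INR m + 1) * (3 * INR m + 1 + A))
  + / ((3 * INR m + 2) * (3 * INR m + 2 + A)).

(** The partial sums are [L A] minus the remainder
[L (A + 3 M) - L (3 M)]; monotonicity bounds the latter by a single increment
of [L], because [A <= 3]. *)
Lemma L_expansion A : 0 <= A <= 1 -> is_series (fun m => A * kernel A m) (L A).
Proof.
intros HA.
(* The terms telescope along the remainder [b], and [b 0 = L A]. *)
set (b := fun m => L (A + 3 * INR m) - L (3 * INR m)).
replace (L A) with (b 0%nat)
  by (unfold b; cbn [INR]; rewrite Rmult_0_r, Rplus_0_r, L_0; ring).
apply is_series_ext with (fun m => b m - b (S m)).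
- intros m. unfold b. pose proof (pos_INR m) as Hm. rewrite S_INR.
  set (x := INR m) in *.
  replace (A + 3 * (x + 1)) with (A + 3 * x + 3) by ring.
  replace (3 * (x + 1)) with (3 * x + 3) by ring.
  assert (E1 := L_shift (A + 3 * x)). assert (E2 := L_shift (3 * x)).
  apply Rminus_diag_uniq. unfold kernel. fold x.
  assert (E3 : A * (/ ((3 * x + 1) * (3 * x + 1 + A)) +
            / ((3 * x + 2) * (3 * x + 2 + A)))
    = (/ (3 * x + 1) + / (3 * x + 2)) - (/ (A + 3 * x + 1) + / (A + 3 * x + 2))).
  { field. repeat split; lra. }
  rewrite E3, <- E1, <- E2 by lra. ring.
- apply is_series_telescope.
  apply is_lim_seq_le_le with (fun _ => 0) (fun m => 2 * / INR (S m)).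
  + intros m. unfold b. pose proof (pos_INR m) as Hm. split.
    * apply Rle_minus_r. rewrite Rplus_0_l. apply L_incr; lra.
    * assert (H1 : L (A + 3 * INR m) <= L (3 * INR m + 3)) by (apply L_incr; lra).
      assert (E := L_shift (3 * INR m)). rewrite S_INR.
      assert (/ (3 * INR m + 1) <= / (INR m + 1)) by (apply Rinv_le_contravar; lra).
      assert (/ (3 * INR m + 2) <= / (INR m + 1)) by (apply Rinv_le_contravar; lra).
      lra.
  + apply is_lim_seq_const.
  + replace (Finite 0) with (Rbar_mult 2 0) by (cbn; now rewrite Rmult_0_r).
    apply is_lim_seq_scal_l.
    exact is_lim_seq_inv_INR_S.
Qed.

(** * First-order expansion of the hypergeometric side *)

Definition growth (j : nat) (A : R) : R := weight j A / weight j 0.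

(** Logarithmic derivative of [step i] at [A = 0]. *)
Definition step_slope (i : nat) : R :=
  4 / (3 * INR i) - / (2 * INR i) - / (2 * INR i + 1).

(** Logarithmic derivative of [weight j] at [A = 0]; the initial [-1] comes from
[/ (A + 1)]. *)
Fixpoint slope (j : nat) : R :=
  match j with
  | O => -1
  | S j' => slope j' + step_slope j
  end.

Lemma growth_S j A :
  growth (S j) A = growth j A * (step (S j) A / step (S j) 0).
Proof.
unfold growth. cbn [weight].
pose proof (weight_pos j 0 (Rle_refl 0)). pose proof (step_pos j 0 (Rle_refl 0)).
field. lra.
Qed.

Lemma step_slope_bound j : 0 <= step_slope (S j) <= / INR (S j).
Proof.
unfold step_slope. pose proof (INR_S_ge1 j) as Hi. set (i := INR (S j)) in *.
assert (/ (2 * i + 1) <= / (2 * i)) by (apply Rinv_le_contravar; lra).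
assert (0 < / (2 * i + 1)) by (apply Rinv_0_lt_compat; lra).
assert (0 < / i) by (apply Rinv_0_lt_compat; lra).
replace (4 / (3 * i)) with (4 / 3 * / i) by (field; lra).
assert (E : / (2 * i) = / 2 * / i) by (field; lra). rewrite E in *.
split; lra.
Qed.

(** The ratio equals
[(1 + A/i)(1 + A/(3i)) / ((1 + A/(2i))(1 + A/(2i+1)))], where [1 + A/(3i)] is
at most [1 + A/(2i)]. *)
Lemma step_ratio_bound j A : 0 <= A ->
  0 <= step (S j) A / step (S j) 0 - 1 <= A / INR (S j).
Proof.
intros HA. pose proof (step_pos j 0 (Rle_refl 0)) as H0. split.
- apply Rle_minus_r. rewrite Rplus_0_l. apply Rle_div_r; [trivial|].
  rewrite Rmult_1_l. apply step_incr; lra.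
- enough (step (S j) A / step (S j) 0 <= 1 + A / INR (S j)) by lra.
  unfold step in *. pose proof (INR_S_ge1 j) as Hi. set (i := INR (S j)) in *.
  replace (_ / _) with ((1 + A / i) *
    (2 * (A + 3 * i) * (2 * i + 1) / (3 * (A + 2 * i) * (A + 2 * i + 1))))
    by (field; repeat split; lra).
  rewrite <- (Rmult_1_r (1 + A / i)) at 2. apply Rmult_le_compat_l.
  + assert (0 <= A / i) by (apply Rdiv_le_0_compat; lra). lra.
  + apply Rle_div_l; nra.
Qed.

Lemma step_ratio_first_order j A : 0 <= A <= 1 ->
  Rabs (step (S j) A / step (S j) 0 - 1 - A * step_slope (S j)) <= 2 * A ^ 2.
Proof.
intros HA. pose proof (step_slope_bound j) as Hd. revert Hd.
set (d := step_slope (S j)).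
assert (Ed : d = step_slope (S j)) by reflexivity. clearbody d. revert Ed.
unfold step_slope, step. pose proof (INR_S_ge1 j) as Hi. set (i := INR (S j)) in *.
intros Ed Hd.
(* In terms of [y] and [z], the error is [A ^ 2] times a bounded polynomial in
   [A], [y], [z], divided by a denominator that is at least [1]. *)
set (y := / i) in *. set (z := / (2 * i + 1)) in *.
assert (Hy : 0 < y <= 1).
{ split; [apply Rinv_0_lt_compat; lra|].
  rewrite <- Rinv_1. apply Rinv_le_contravar; lra. }
assert (Hz : 0 < z <= / 3).
{ split; [apply Rinv_0_lt_compat; lra|]. apply Rinv_le_contravar; lra. }
assert (Ed' : d = 5 / 6 * y - z) by (rewrite Ed; unfold y, z; field; lra).
replace (_ - _ - _) with
  (A ^ 2 * ((y * y / 3 - y * z / 2 - (y / 2 + z) * d - A * d * (y * z / 2))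
    / ((1 + A * y / 2) * (1 + A * z))))
  by (rewrite Ed'; unfold y, z; field; repeat split; lra).
rewrite Rabs_mult, (Rabs_pos_eq (A ^ 2)), Rmult_comm by apply pow2_ge_0.
apply Rmult_le_compat_r; [apply pow2_ge_0|].
assert (Ay : 0 <= A * y) by (apply Rmult_le_pos; lra).
assert (Az : 0 <= A * z) by (apply Rmult_le_pos; lra).
assert (HD : 1 <= (1 + A * y / 2) * (1 + A * z)) by nra.
assert (Hyy : 0 <= y * y <= 1) by nra.
assert (Hyz : 0 <= y * z <= 1) by nra.
assert (Hed : 0 <= (y / 2 + z) * d <= 1) by nra.
assert (HAd : 0 <= A * d <= 1) by nra.
assert (Hlast : 0 <= A * d * (y * z / 2) <= / 2) by nra.
rewrite Rabs_div by lra. rewrite (Rabs_pos_eq (_ * _)) by lra.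
apply Rle_div_l; [lra|].
apply Rle_trans with 2; [|lra].
apply Rabs_le. lra.
Qed.

(** The product of the bounds [1 + 1/i] telescopes, so the growth is at most linear
in [j]; this polynomial loss is harmless against the geometric decay of
[weight j 0]. *)
Lemma growth_bound j A : 0 <= A <= 1 -> 0 < growth j A <= INR (S j).
Proof.
intros HA. split.
- apply Rdiv_lt_0_compat; apply weight_pos; lra.
- induction j as [|j IH].
  + unfold growth. cbn [weight INR]. apply Rle_div_l.
    * rewrite Rplus_0_l, Rinv_1. lra.
    * rewrite Rmult_1_l. apply Rinv_le_contravar; lra.
  + rewrite growth_S, (S_INR (S j)).
    pose proof (step_ratio_bound j A (proj1 HA)) as Hs.
    pose proof (INR_S_ge1 j) as Hi.
    apply Rle_trans with (INR (S j) * (1 + / INR (S j))).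
    * apply Rmult_le_compat; [|lra|trivial|].
      -- left; apply Rdiv_lt_0_compat; apply weight_pos; lra.
      -- assert (A / INR (S j) <= / INR (S j)).
         { apply Rle_div_l; [lra|]. rewrite Rinv_l; lra. }
         lra.
    * right. field. lra.
Qed.

Lemma growth_minus_1_bound j A :
  0 <= A <= 1 -> Rabs (growth j A - 1) <= A * INR (S j).
Proof.
intros HA. induction j as [|j IH].
- unfold growth. cbn [weight INR].
  replace (_ - _) with (- (A / (A + 1))) by (field; lra).
  rewrite Rabs_Ropp, Rabs_pos_eq by (apply Rdiv_le_0_compat; lra).
  apply Rle_div_l; nra.
- rewrite growth_S, (S_INR (S j)).
  pose proof (step_ratio_bound j A (proj1 HA)) as Hs.
  pose proof (growth_bound j A HA) as Hg.
  pose proof (INR_S_ge1 j) as Hi. set (i := INR (S j)) in *.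
  set (r := step (S j) A / step (S j) 0) in *.
  replace (growth j A * r - 1) with (growth j A - 1 + growth j A * (r - 1)) by ring.
  eapply Rle_trans; [apply Rabs_triang|].
  rewrite (Rabs_pos_eq (_ * _)) by (apply Rmult_le_pos; lra).
  assert (growth j A * (r - 1) <= i * (A / i)) by (apply Rmult_le_compat; lra).
  replace (i * (A / i)) with A in * by (field; lra). lra.
Qed.

(** Passing from [j] to [j + 1], with [r] the ratio of steps and [d] its slope, the
error [growth - 1 - A * slope] increases by [growth * (r - 1 - A d)], at most
[2 A^2 (j+1)], plus [(growth - 1) * A d], at most [A^2 (j+1)]. *)
Lemma growth_first_order j A : 0 <= A <= 1 ->
  Rabs (growth j A - 1 - A * slope j) <= 3 * A ^ 2 * INR (S j) ^ 2.
Proof.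
intros HA. induction j as [|j IH].
- unfold growth. cbn [weight INR slope].
  replace (_ - _ - _) with (A ^ 2 / (A + 1)) by (field; lra).
  pose proof (pow2_ge_0 A).
  rewrite Rabs_pos_eq by (apply Rdiv_le_0_compat; lra).
  apply Rle_div_l; [lra|]. nra.
- rewrite growth_S, (S_INR (S j)). cbn [slope].
  pose proof (step_ratio_first_order j A HA) as Hs.
  pose proof (growth_bound j A HA) as Hg.
  pose proof (growth_minus_1_bound j A HA) as Hg1.
  pose proof (step_slope_bound j) as Hd.
  pose proof (INR_S_ge1 j) as Hi.
  assert (Hd1 : step_slope (S j) <= 1).
  { apply Rle_trans with (/ INR (S j)); [lra|].
    rewrite <- Rinv_1. apply Rinv_le_contravar; lra. }
  set (i := INR (S j)) in *. set (d := step_slope (S j)) in *.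
  set (r := step (S j) A / step (S j) 0) in *.
  replace (growth j A * r - 1 - A * (slope j + d)) with
    ((growth j A - 1 - A * slope j) + (growth j A * (r - 1 - A * d)
      + (growth j A - 1) * (A * d))) by ring.
  eapply Rle_trans; [apply Rabs_triang|].
  eapply Rle_trans; [apply Rplus_le_compat; [exact IH|apply Rabs_triang]|].
  rewrite !Rabs_mult, (Rabs_pos_eq (growth j A)), (Rabs_pos_eq A), (Rabs_pos_eq d)
    by lra.
  assert (growth j A * Rabs (r - 1 - A * d) <= i * (2 * A ^ 2))
    by (apply Rmult_le_compat; try lra; apply Rabs_pos).
  assert (Rabs (growth j A - 1) * (A * d) <= A * i * (A * 1)).
  { apply Rmult_le_compat; trivial.
    - apply Rabs_pos.
    - apply Rmult_le_pos; lra.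
    - apply Rmult_le_compat_l; lra. }
  pose proof (pow2_ge_0 A). nra.
Qed.

Lemma slope_bound j : Rabs (slope j) <= INR (S j).
Proof.
induction j as [|j IH].
- cbn [slope INR]. rewrite Rabs_left; lra.
- cbn [slope]. rewrite (S_INR (S j)).
  pose proof (step_slope_bound j) as Hd. pose proof (INR_S_ge1 j) as Hi.
  assert (/ INR (S j) <= 1) by (rewrite <- Rinv_1; apply Rinv_le_contravar; lra).
  eapply Rle_trans; [apply Rabs_triang|].
  rewrite (Rabs_pos_eq (step_slope _)) by lra. lra.
Qed.

Lemma weight_0_le j : weight j 0 <= (3 / 4) ^ j.
Proof.
induction j as [|j IH]; cbn [weight pow].
- rewrite Rplus_0_l, Rinv_1. lra.
- rewrite (Rmult_comm (3 / 4)). apply Rmult_le_compat; trivial.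
  + left; apply weight_pos; lra.
  + left; apply step_pos; lra.
  + pose proof (INR_S_ge1 j). apply step_le; nra.
Qed.

Lemma ex_series_linear_weight :
  ex_series (fun j => INR (S j) * weight j 0).
Proof.
apply ex_series_dominated with (fun j => 6 * (7 / 8) ^ j).
- intros j. pose proof (INR_S_ge1 j) as Hi.
  pose proof (weight_pos j 0 (Rle_refl 0)) as Hw.
  rewrite Rabs_pos_eq by (apply Rmult_le_pos; lra).
  (* Bernoulli's inequality bounds the linear factor by [6 (7/6)^j]. *)
  replace (7 / 8) with (7 / 6 * (3 / 4)) by field.
  rewrite Rpow_mult_distr, <- Rmult_assoc.
  apply Rmult_le_compat; [lra|lra| |apply weight_0_le].
  assert (H := poly j (/ 6)). rewrite S_INR.
  replace (7 / 6) with (1 + / 6) by field. lra.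
- apply (ex_series_scal 6 (fun j => (7 / 8) ^ j)).
  apply ex_series_geom. rewrite Rabs_pos_eq; lra.
Qed.

(** * First-order expansion of the zeta side *)

Definition kernel_cubes (m : nat) : R :=
  / (3 * INR m + 1) ^ 3 + / (3 * INR m + 2) ^ 3.

Lemma kernel_first_order A m : 0 <= A ->
  Rabs (kernel A m - kernel 0 m - A * - kernel_cubes m)
  <= A ^ 2 * (2 * / INR (S m) ^ 2).
Proof.
intros HA. pose proof (pos_INR m) as Hm. unfold kernel, kernel_cubes.
rewrite S_INR. set (x := INR m) in *.
replace (_ - _ - _) with (A ^ 2 *
  (/ ((3 * x + 1) ^ 3 * (3 * x + 1 + A)) + / ((3 * x + 2) ^ 3 * (3 * x + 2 + A))))
  by (field; lra).
assert (B : forall n, x + 1 <= n -> 0 < / (n ^ 3 * (n + A)) <= / (x + 1) ^ 2).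
{ intros n Hn. assert (0 < (x + 1) ^ 2) by nra.
  assert ((x + 1) ^ 2 <= n ^ 3 * (n + A)).
  { assert ((x + 1) ^ 2 <= n ^ 2) by (apply pow_incr; lra).
    assert (1 <= n * (n + A)) by nra. nra. }
  split; [apply Rinv_0_lt_compat; lra|apply Rinv_le_contravar; lra]. }
assert (B1 := B (3 * x + 1)). assert (B2 := B (3 * x + 2)).
rewrite Rabs_mult, (Rabs_pos_eq (A ^ 2)) by apply pow2_ge_0.
apply Rmult_le_compat_l; [apply pow2_ge_0|].
rewrite Rabs_pos_eq; lra.
Qed.

Lemma ex_series_kernel_0 : ex_series (kernel 0).
Proof.
apply ex_series_dominated with (fun m => 2 * / INR (S m) ^ 2).
- intros m. pose proof (pos_INR m) as Hm. unfold kernel. rewrite S_INR.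
  set (x := INR m) in *.
  assert (B : forall n, x + 1 <= n -> 0 < / (n * (n + 0)) <= / (x + 1) ^ 2).
  { intros n Hn. split; [apply Rinv_0_lt_compat; nra|apply Rinv_le_contravar; nra]. }
  assert (B1 := B (3 * x + 1)). assert (B2 := B (3 * x + 2)).
  rewrite Rabs_pos_eq; lra.
- apply (ex_series_scal 2 (fun m => / INR (S m) ^ 2)). exact ex_series_inv_squares.
Qed.

(** Removing from [zeta3] the cubes of the multiples of [3] removes [zeta3 / 27]. *)
Lemma is_series_kernel_cubes : is_series kernel_cubes (26 / 27 * zeta3).
Proof.
set (c := fun m => / INR (S m) ^ 3).
assert (Hc : is_lim_seq (sum_n c) zeta3).
{ apply (Series_correct c). exact ex_series_inv_cubes. }
assert (H : is_lim_seq (sum_n kernel_cubes) (26 / 27 * zeta3)); [|exact H].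
apply is_lim_seq_ext with (fun n => sum_n c (3 * n + 2) - / 27 * sum_n c n).
- intros n. induction n as [|n IH].
  + cbn [Nat.mul Nat.add]. rewrite !sum_Sn, !sum_O. change plus with Rplus.
    unfold c, kernel_cubes. cbn [INR]. field.
  + rewrite (sum_Sn kernel_cubes), <- IH.
    replace (3 * S n + 2)%nat with (S (S (S (3 * n + 2)))) by lia.
    rewrite !(sum_Sn c). change plus with Rplus. cbn beta.
    unfold c, kernel_cubes. rewrite !S_INR, plus_INR, mult_INR. cbn [INR].
    pose proof (pos_INR n). field. repeat split; lra.
- replace (26 / 27 * zeta3) with (zeta3 - / 27 * zeta3) by field.
  apply is_lim_seq_minus'.
  + apply (is_lim_seq_subseq (sum_n c) zeta3 (fun n => 3 * n + 2)%nat); trivial.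
    apply eventually_subseq. intros n; lia.
  + apply (is_lim_seq_scal_l (sum_n c) (/ 27) zeta3). trivial.
Qed.

(** * Comparison of the two expansions *)

Lemma ex_series_weight_slope : ex_series (fun j => weight j 0 * slope j / INR (S j)).
Proof.
apply ex_series_dominated with (fun j => weight j 0).
- intros j. pose proof (INR_S_ge1 j) as Hi. pose proof (slope_bound j).
  pose proof (weight_pos j 0 (Rle_refl 0)).
  rewrite Rabs_div, Rabs_mult, !(Rabs_pos_eq (weight _ _)), (Rabs_pos_eq (INR _)) by lra.
  apply Rle_div_l; [lra|]. apply Rmult_le_compat_l; lra.
- apply ex_series_weight; lra.
Qed.

(** The coefficients of [A] in the two expansions of [L A / A] agree. *)
Lemma is_series_weight_slope :
  is_series (fun j => weight j 0 * slope j / INR (S j)) (- (26 / 27 * zeta3)).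
Proof.
assert (Hk := is_series_kernel_cubes).
assert (Hexk : ex_series kernel_cubes) by (eexists; exact Hk).
rewrite <- (is_series_unique _ _ Hk).
set (b := fun j => weight j 0 * slope j / INR (S j)).
enough (E : Series (fun j => b j + kernel_cubes j) = 0).
{ rewrite Series_plus in E by (trivial; exact ex_series_weight_slope).
  replace (- Series kernel_cubes) with (Series b) by lra.
  apply Series_correct, ex_series_weight_slope. }
apply (Series_first_order_coeff
  (fun x j => weight j x / INR (S j) - kernel x j)
  (fun j => weight j 0 / INR (S j) - kernel 0 j) _
  (fun j => 3 * (INR (S j) * weight j 0) + 2 * / INR (S j) ^ 2)).
- apply (ex_series_minus (fun j => weight j 0 / INR (S j)) (kernel 0));
    [|exact ex_series_kernel_0].
  apply ex_series_dominated with (fun j => weight j 0); [|apply ex_series_weight; lra].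
  intros j. pose proof (INR_S_ge1 j). pose proof (weight_pos j 0 (Rle_refl 0)).
  rewrite Rabs_pos_eq by (apply Rdiv_le_0_compat; lra).
  apply Rle_div_l; [lra|]. nra.
- apply (ex_series_plus b kernel_cubes); [exact ex_series_weight_slope|trivial].
- apply (ex_series_plus (fun j => 3 * (INR (S j) * weight j 0))
    (fun j => 2 * / INR (S j) ^ 2)).
  + apply (ex_series_scal 3 (fun j => INR (S j) * weight j 0)).
    exact ex_series_linear_weight.
  + apply (ex_series_scal 2 (fun j => / INR (S j) ^ 2)).
    exact ex_series_inv_squares.
- intros x j Hx. pose proof (INR_S_ge1 j) as Hi.
  pose proof (weight_pos j 0 (Rle_refl 0)) as Hw.
  assert (H1 : Rabs (growth j x - 1 - x * slope j) <= 3 * x ^ 2 * INR (S j) ^ 2)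
    by (apply growth_first_order; lra).
  assert (H2 := kernel_first_order x j).
  replace (_ - _ - _) with
    (weight j 0 / INR (S j) * (growth j x - 1 - x * slope j)
     + - (kernel x j - kernel 0 j - x * - kernel_cubes j))
    by (unfold b, growth; field; lra).
  eapply Rle_trans; [apply Rabs_triang|].
  rewrite Rabs_Ropp, Rabs_mult, Rmult_plus_distr_l.
  apply Rplus_le_compat; [|apply H2; lra].
  rewrite (Rabs_pos_eq (_ / _)) by (apply Rdiv_le_0_compat; lra).
  replace (x ^ 2 * _) with (weight j 0 / INR (S j) * (3 * x ^ 2 * INR (S j) ^ 2))
    by (field; lra).
  apply Rmult_le_compat_l; [apply Rdiv_le_0_compat; lra|trivial].
- intros x Hx.
  assert (HL : is_series (summand x) (L x))
    by (apply Series_correct, ex_series_summand; lra).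
  assert (HL' := L_expansion x (conj (Rlt_le _ _ (proj1 Hx)) (proj2 Hx))).
  assert (HD := is_series_minus _ _ _ _ HL HL').
  assert (HS := is_series_scal (/ x) _ _ HD).
  replace (scal _ _) with 0 in HS
    by (unfold scal, plus, opp; cbn; unfold mult; cbn; ring).
  revert HS. apply is_series_ext. intros j. pose proof (INR_S_ge1 j).
  unfold scal, plus, opp; cbn -[INR]; unfold mult, summand; cbn -[INR]. field. lra.
Qed.

(** * Translation to binomial coefficients and harmonic numbers *)

Lemma central_binomial_S k :
  Binomial.C (2 * S k) (S k)
  = Binomial.C (2 * k) k * (2 * (2 * INR k + 1) / INR (S k)).
Proof.
unfold Binomial.C.
replace (2 * S k - S k)%nat with (S k) by lia.
replace (2 * k - k)%nat with k by lia.
replace (2 * S k)%nat with (S (S (2 * k))) by lia.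
rewrite !fact_simpl, !mult_INR, !S_INR, mult_INR. cbn [INR].
pose proof (pos_INR k). pose proof (INR_fact_neq_0 k).
field. split; lra.
Qed.

Lemma central_binomial_pos k : 0 < Binomial.C (2 * k) k.
Proof.
induction k as [|k IH].
- unfold Binomial.C. cbn. lra.
- rewrite central_binomial_S. pose proof (INR_S_ge1 k). pose proof (pos_INR k).
  apply Rmult_lt_0_compat; trivial. apply Rdiv_lt_0_compat; lra.
Qed.

Lemma weight_0_central_binomial j :
  weight j 0 = 2 / 3 * (3 ^ S j / (INR (S j) * Binomial.C (2 * S j) (S j))).
Proof.
induction j as [|j IH].
- rewrite central_binomial_S. unfold Binomial.C. cbn. field.
- cbn [weight]. rewrite IH, (central_binomial_S (S j)). unfold step.
  pose proof (central_binomial_pos (S j)). rewrite (S_INR (S j)).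
  pose proof (INR_S_ge1 j). set (i := INR (S j)) in *.
  rewrite <- (tech_pow_Rmult 3 (S j)).
  field. repeat split; lra.
Qed.

Lemma S1_S n : S1 (S n) = S1 n + / INR (S n).
Proof. unfold S1. rewrite sum_n_Sm by lia. reflexivity. Qed.

Lemma slope_harmonic j :
  -6 * slope j = 6 * S1 (2 * S j) - 8 * S1 (S j) + 5 / INR (S j).
Proof.
induction j as [|j IH].
- cbn [Nat.mul Nat.add slope]. rewrite !S1_S. unfold S1.
  rewrite sum_n_m_zero by lia. change (zero : R) with 0. cbn [INR]. field.
- cbn [slope]. rewrite Rmult_plus_distr_l, IH.
  replace (2 * S (S j))%nat with (S (S (2 * S j))) by lia.
  rewrite (S1_S (S (2 * S j))), (S1_S (2 * S j)), (S1_S (S j)).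
  unfold step_slope. rewrite (S_INR (S (2 * S j))), (S_INR (2 * S j)), mult_INR.
  rewrite (S_INR (S j)). replace (INR 2) with 2 by reflexivity.
  pose proof (INR_S_ge1 j). set (i := INR (S j)) in *.
  field. repeat split; lra.
Qed.

Theorem mainTheorem12 :
  is_series
    (fun j : nat =>
       let k := S j in
       3 ^ k / ((INR k) ^ 2 * Binomial.C (2 * k) k)
       * (6 * S1 (2 * k) - 8 * S1 k + 5 / INR k))
    (26 / 3 * zeta3).
Proof.
assert (H := is_series_scal (-9) _ _ is_series_weight_slope).
replace (26 / 3 * zeta3) with (scal (-9) (- (26 / 27 * zeta3)))
  by (unfold scal; cbn; unfold mult; cbn; field).
revert H. apply is_series_ext. intros j. cbn zeta.
rewrite <- slope_harmonic, weight_0_central_binomial.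
match goal with |- ?a = ?b => change (@eq R a b) end.
change (scal (-9) ?b) with (-9 * b).
pose proof (INR_S_ge1 j). pose proof (central_binomial_pos (S j)).
field. lra.
Qed.
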